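(* Let $L$ be a finite BL-comet with $pivot(L)<1$. Then there is no commutative unitary ring $R$ such that $Id(R)=L$, i.e. such that the residuated lattice $Id(R)$ of ideals of $R$ is isomorphic to $L$.
   Context: A (commutative) residuated lattice is an algebra $(L,\wedge,\vee,\odot,\rightarrow,0,1)$ such that $(L,\wedge,\vee,0,1)$ is a bounded lattice with order $\leq$, $(L,\odot,1)$ is a commutative ordered monoid, and $z\leq x\rightarrow y$ iff $x\odot z\leq y$ for all $x,y,z\in L$. A BL-algebra is a residuated lattice satisfying $(x\rightarrow y)\vee(y\rightarrow x)=1$ and $x\odot(x\rightarrow y)=x\wedge y$ for all $x,y$. For a finite BL-algebra $L$, let $\mathcal{I}(L)=\{x\in L: x\odot x=x\}$, and for $x\in\mathcal{I}(L)$ let $\mathcal{C}(x)$ be the set of $y\in\mathcal{I}(L)$ comparable with $x$. Let $\mathcal{D}(L)$ be the set of $x\in\mathcal{I}(L)$ such that $\mathcal{C}(x)=\mathcal{I}(L)$ and $\{y\in\mathcal{I}(L): y\leq x\}$ is a chain. Then $0\in\mathcal{D}(L)$, and $L$ is called a BL-comet if $\max\mathcal{D}(L)\neq 0$; in that case $pivot(L)=\max\mathcal{D}(L)$. For a commutative unitary ring $R$, $Id(R)$ denotes the set of all ideals of $R$, which is a residuated lattice $(Id(R),\cap,+,\otimes,\rightarrow,\{0\},R)$ ordered by inclusion, where $I\otimes J$ is the product of ideals (finite sums of products $ij$, $i\in I$, $j\in J$) and $I\rightarrow J=(J:I)=\{x\in R: xI\subseteq J\}$. *)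

(* Defs.v *)
From HB Require Import structures.
From mathcomp Require Import all_boot all_order all_algebra.
From mathcomp Require Import boolp classical_sets.

Set Implicit Arguments.
Unset Strict Implicit.
Unset Printing Implicit Defensive.

Import Order.TTheory GRing.Theory.

Local Open Scope order_scope.

(* The constants 0 and 1 of a residuated lattice are \bot and \top.  The
   one-element algebra (\bot = \top) is allowed. *)
HB.mixin Record isResiduated (d : Order.disp_t) T of Order.TBLattice d T := {
  odot : T -> T -> T;
  rimp : T -> T -> T;
  odotA : associative odot;
  odotC : commutative odot;
  odot1x : left_id (\top : T) odot;
  odot_le : forall x y z : T, x <= y -> odot x z <= odot y z;
  residuation : forall x y z : T, (z <= rimp x y) = (odot x z <= y)
}.

#[short(type="residuatedLatticeType")]
HB.structure Definition ResiduatedLattice (d : Order.disp_t) :=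
  { T of Order.TBLattice d T & isResiduated d T }.

Notation "x ⊙ y" := (odot x y) (at level 40, left associativity) : order_scope.
Notation "x ⟶ y" := (rimp x y) (at level 55, right associativity) : order_scope.

HB.mixin Record isBL (d : Order.disp_t) T of ResiduatedLattice d T := {
  prelinearity : forall x y : T, (x ⟶ y) `|` (y ⟶ x) = \top;
  divisibility : forall x y : T, x ⊙ (x ⟶ y) = x `&` y
}.

#[short(type="blAlgebraType")]
HB.structure Definition BLAlgebra (d : Order.disp_t) :=
  { T of ResiduatedLattice d T & isBL d T }.

#[short(type="finBLAlgebraType")]
HB.structure Definition FinBLAlgebra (d : Order.disp_t) :=
  { T of BLAlgebra d T & Finite T }.

Definition residuated_isomorphic (d d' : Order.disp_t)
    (A : residuatedLatticeType d) (B : residuatedLatticeType d') : Prop :=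
  exists f : A -> B,
    bijective f /\
    [/\ {morph f : x y / x `&` y}, {morph f : x y / x `|` y},
        {morph f : x y / x ⊙ y} & {morph f : x y / x ⟶ y}] /\
    f \bot = \bot /\ f \top = \top.

Section Comets.
Variables (d : Order.disp_t) (L : finBLAlgebraType d).

Definition idempotents : {set L} := [set x : L | x ⊙ x == x]%SET.

Definition comparables (x : L) : {set L} :=
  [set y : L in idempotents | x >=< y]%SET.

Definition is_chain (A : {set L}) : bool :=
  [forall x in A, forall y in A, x >=< y].

Definition comet_set : {set L} :=
  [set x : L in idempotents |
    (comparables x == idempotents) &&
    is_chain [set y : L in idempotents | y <= x]]%SET.

(* \bot is only the default value of [arg max]; it is never used as such:
   pivotP below shows that comet_set always has a greatest element. *)
Definition pivot : L := [arg max_(x > \bot in comet_set) x].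

Definition is_BL_comet : Prop := pivot != \bot.

Lemma odot_bot : (\bot : L) ⊙ \bot = \bot.
Proof. by apply/eqP; rewrite -lex0 -residuation le0x. Qed.

Lemma bot_comet_set : (\bot : L) \in comet_set.
Proof.
rewrite !inE odot_bot eqxx /=; apply/andP; split.
  by apply/eqP/setP => y; rewrite !inE /Order.comparable le0x andbT.
apply/'forall_implyP => x; rewrite !inE => /andP[_]; rewrite lex0 => /eqP ->.
by apply/'forall_implyP => y _; rewrite /Order.comparable le0x.
Qed.

Lemma comet_set_comparable (x y : L) :
  x \in comet_set -> y \in comet_set -> x >=< y.
Proof.
rewrite !inE => /and3P[_ /eqP Cx _] /and3P[Iy _ _].
by have : y \in comparables x; [rewrite Cx inE | rewrite inE => /andP[]].
Qed.

Lemma pivotP : pivot \in comet_set /\ forall x, x \in comet_set -> x <= pivot.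
Proof.
suff [p pD pmax] : exists2 p, p \in comet_set & forall x, x \in comet_set -> x <= p.
  rewrite /pivot /Order.arg_max /extremum; case: pickP => [q /andP[qD /forallP qm]|].
    by split=> // x xD; have := qm x; rewrite xD.
  move=> /(_ p)/negbT/negP[]; apply/andP; split=> //.
  by apply/forallP => x; apply/implyP => xD; apply: pmax.
have [p pD pmax] := arg_maxnP (fun x : L => #|[set y : L | y <= x]%SET|) bot_comet_set.
exists p => // x xD; have := comet_set_comparable xD pD.
rewrite /Order.comparable => /orP[//|px].
have sub : [set y : L | y <= p]%SET \subset [set y : L | y <= x]%SET.
  by apply/fintype.subsetP => y; rewrite !inE => /le_trans; apply.
have /eqP E : [set y : L | y <= p]%SET == [set y : L | y <= x]%SET.
  by rewrite eqEcard sub; apply: pmax.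
by have : x \in [set y : L | y <= p]%SET; [rewrite E inE | rewrite inE].
Qed.

End Comets.

Arguments is_BL_comet {d} L.
Arguments pivot {d} L.

Local Close Scope order_scope.
Local Open Scope ring_scope.
Local Open Scope classical_set_scope.

(* The ideals of R, R itself included. *)
Definition is_ideal (R : comPzRingType) (I : set R) : Prop :=
  [/\ I 0, forall x y, I x -> I y -> I (x + y) & forall a x, I x -> I (a * x)].

Record ideal (R : comPzRingType) := Ideal {
  ideal_set :> R -> Prop;
  idealP : is_ideal ideal_set
}.

Section Ideals.
Variable R : comPzRingType.
Implicit Types I J K : ideal R.

Lemma ideal_ext I J : ideal_set I = ideal_set J -> I = J.
Proof.
case: I J => [I hI] [J hJ] /= E; case: _ / E in hJ *.
by congr Ideal; apply: Prop_irrelevance.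
Qed.

Lemma ideal0 I : I 0. Proof. by case: (idealP I). Qed.
Lemma idealD I x y : I x -> I y -> I (x + y).
Proof. by case: (idealP I) => _ h _; apply: h. Qed.
Lemma idealMl I a x : I x -> I (a * x).
Proof. by case: (idealP I) => _ _; apply. Qed.
Lemma idealMr I a x : I x -> I (x * a).
Proof. by rewrite mulrC; apply: idealMl. Qed.
Lemma ideal_sum I n (F : 'I_n -> R) : (forall i, I (F i)) -> I (\sum_i F i).
Proof.
by move=> h; apply: (big_ind (fun x => I x)) => // [|x y]; [apply: ideal0|apply: idealD].
Qed.

Definition idI_set I J : set R := [set x | I x /\ J x].
Definition idD_set I J : set R :=
  [set x | exists a b : R, [/\ I a, J b & x = a + b]].
Definition idM_set I J : set R :=
  [set x | exists (n : nat) (a b : 'I_n -> R),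
     [/\ forall k, I (a k), forall k, J (b k) & x = \sum_k a k * b k]].
Definition idR_set I J : set R := [set x | forall i, I i -> J (x * i)].
Definition id0_set : set R := [set 0].
Definition id1_set : set R := setT.

Lemma idI_ideal I J : is_ideal (idI_set I J).
Proof.
split=> [|x y [? ?] [? ?]|a x [? ?]].
- by split; apply: ideal0.
- by split; apply: idealD.
- by split; apply: idealMl.
Qed.

Lemma idD_ideal I J : is_ideal (idD_set I J).
Proof.
split=> [|_ _ [a [b [Ia Jb ->]]] [a' [b' [Ia' Jb' ->]]]|r _ [a [b [Ia Jb ->]]]].
- by exists 0, 0; split; rewrite ?addr0 //; apply: ideal0.
- by exists (a + a'), (b + b'); split; [exact: idealD|exact: idealD|rewrite addrACA].
- by exists (r * a), (r * b); split; [exact: idealMl|exact: idealMl|rewrite mulrDr].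
Qed.

Lemma idM_ideal I J : is_ideal (idM_set I J).
Proof.
split=> [|_ _ [n [a [b [Ia Jb ->]]]] [n' [a' [b' [Ia' Jb' ->]]]]|r _ [n [a [b [Ia Jb ->]]]]].
- by exists 0%N, (fun=> 0), (fun=> 0); split=> [[]|[]|] //; rewrite big_ord0.
- exists (n + n')%N,
    (fun k => match fintype.split k with inl i => a i | inr i => a' i end),
    (fun k => match fintype.split k with inl i => b i | inr i => b' i end).
  split=> [k|k|]; try by case: fintype.split.
  rewrite big_split_ord /=; congr (_ + _); apply: eq_bigr => k _.
    by rewrite (unsplitK (inl k)).
  by rewrite (unsplitK (inr k)).
- exists n, (fun k => r * a k), b; split=> // [k|]; first exact: idealMl.
  by rewrite mulr_sumr; apply: eq_bigr => k _; rewrite mulrA.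
Qed.

Lemma idR_ideal I J : is_ideal (idR_set I J).
Proof.
split=> [i _|x y hx hy i Ii|a x hx i Ii].
- by rewrite mul0r; apply: ideal0.
- by rewrite mulrDl; apply: idealD; [apply: hx|apply: hy].
- by rewrite -mulrA; apply: idealMl; apply: hx.
Qed.

Lemma id0_ideal : is_ideal id0_set.
Proof. by split=> [//|x y -> ->|a x ->]; rewrite /id0_set /= ?addr0 ?mulr0. Qed.

Lemma id1_ideal : is_ideal id1_set. Proof. by []. Qed.

Definition idI I J : ideal R := Ideal (idI_ideal I J).
Definition idD I J : ideal R := Ideal (idD_ideal I J).
Definition idM I J : ideal R := Ideal (idM_ideal I J).
Definition idR I J : ideal R := Ideal (idR_ideal I J).
Definition id0 : ideal R := Ideal id0_ideal.
Definition id1 : ideal R := Ideal id1_ideal.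

Definition id_le I J : bool := `[< ideal_set I `<=` ideal_set J >].

Lemma id_leP I J : reflect (ideal_set I `<=` ideal_set J) (id_le I J).
Proof. exact: asboolP. Qed.

Lemma id_le_refl : reflexive id_le.
Proof. by move=> I; apply/id_leP. Qed.

Lemma id_le_anti : antisymmetric id_le.
Proof.
move=> I J /andP[/id_leP IJ /id_leP JI]; apply: ideal_ext.
by apply/seteqP; split.
Qed.

Lemma id_le_trans : transitive id_le.
Proof. by move=> J I K /id_leP IJ /id_leP JK; apply/id_leP => x /IJ /JK. Qed.

Lemma idIP I J K : id_le I (idI J K) = id_le I J && id_le I K.
Proof.
apply/id_leP/andP => [h|[/id_leP IJ /id_leP IK] x Ix]; last by split; auto.
by split; apply/id_leP => x /h[].
Qed.

Lemma idDP I J K : id_le (idD I J) K = id_le I K && id_le J K.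
Proof.
apply/id_leP/andP => [h|[/id_leP IK /id_leP JK] _ [a [b [Ia Jb ->]]]]; last first.
  by apply: idealD; auto.
split; apply/id_leP => x hx; apply: h.
  by exists x, 0; split=> //; [apply: ideal0|rewrite addr0].
by exists 0, x; split=> //; [apply: ideal0|rewrite add0r].
Qed.

Lemma id0P I : id_le id0 I.
Proof. by apply/id_leP => _ ->; apply: ideal0. Qed.

Lemma id1P I : id_le I id1.
Proof. exact/id_leP. Qed.

Lemma idM_leP I J K : reflect (forall a b, I a -> J b -> K (a * b)) (id_le (idM I J) K).
Proof.
apply: (iffP (id_leP _ _)) => [h a b Ia Jb|h _ [n [a [b [Ia Jb ->]]]]].
  by apply: h; exists 1%N, (fun=> a), (fun=> b); split=> //; rewrite big_ord1.
by apply: ideal_sum => k; apply: h.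
Qed.

Lemma idM_mem I J a b : I a -> J b -> idM I J (a * b).
Proof. by apply: (idM_leP I J _ _ a b); apply: id_le_refl. Qed.

Lemma idM_comm : commutative idM.
Proof.
by move=> I J; apply: id_le_anti; apply/andP; split; apply/idM_leP => a b Ia Jb;
  rewrite mulrC; apply: idM_mem.
Qed.

Lemma id_residuation I J K : id_le K (idR I J) = id_le (idM I K) J.
Proof.
apply/id_leP/idM_leP => [h a b Ia Kb|h x Kx i Ii]; first by rewrite mulrC; apply: (h b).
by rewrite mulrC; apply: h.
Qed.

Lemma idM_assoc : associative idM.
Proof.
have le I J K : id_le (idM I (idM J K)) (idM (idM I J) K).
  rewrite -id_residuation; apply/idM_leP => b c Jb Kc a Ia.
  by rewrite mulrC mulrA; apply: idM_mem => //; apply: idM_mem.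
move=> I J K; apply: id_le_anti; rewrite le /=.
by rewrite (idM_comm _ K) (idM_comm I J) (idM_comm I) (idM_comm J K); apply: le.
Qed.

Lemma id1M : left_id id1 idM.
Proof.
move=> I; apply: id_le_anti; apply/andP; split.
  by apply/idM_leP => a b _; apply: idealMl.
by apply/id_leP => x Ix; rewrite -[x]mul1r; apply: idM_mem.
Qed.

Lemma idM_mono I J K : id_le I J -> id_le (idM I K) (idM J K).
Proof.
by move=> /id_leP IJ; apply/idM_leP => a b Ia Kb; apply: idM_mem => //; apply: IJ.
Qed.

HB.instance Definition _ := gen_eqMixin (ideal R).
HB.instance Definition _ := gen_choiceMixin (ideal R).

Fact ideal_display : Order.disp_t. Proof. exact: (Order.Disp tt tt). Qed.

HB.instance Definition _ :=
  Order.Le_isPOrder.Build ideal_display (ideal R) id_le_refl id_le_anti id_le_trans.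
HB.instance Definition _ :=
  Order.POrder_MeetJoin_isLattice.Build ideal_display (ideal R) idIP idDP.
HB.instance Definition _ := Order.hasBottom.Build ideal_display (ideal R) id0P.
HB.instance Definition _ := Order.hasTop.Build ideal_display (ideal R) id1P.
HB.instance Definition _ := isResiduated.Build ideal_display (ideal R)
  idM_assoc idM_comm id1M idM_mono id_residuation.

End Ideals.

(* Main.v *)
Require Import Defs.
From mathcomp Require Import all_boot all_order all_algebra.
From mathcomp Require Import boolp.

(** An idempotent of the BL-algebra [L] which is comparable with every
    idempotent must be [\bot] or [\top] as soon as [L] is the ideal lattice of
    a ring [R]; the pivot of a BL-comet is such an idempotent, whence the
    theorem.

    Let [P] be the ideal of [R] corresponding to the pivot.  Divisibility makes
    an idempotent [p] of a BL-algebra a local unit ([p ⊙ x = x] for [x <= p],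
    [odot_idem_le]).  Applied to the principal ideal of [x] in [P], it says
    that [x = e * x] for some [e] in [P], which need not be idempotent and
    depends on [x].  Two local units [e1], [e2] combine into
    [1 - (1 - e1) * (1 - e2)], so any two elements of [P] have a common one;
    since [R] has finitely many ideals, a principal ideal that is maximal among
    those contained in [P] then has to be [P], and [P] is generated by an
    idempotent element [e] ([idempotent_generator]).

    The complementary ideal, generated by [1 - e], is idempotent too, hence
    comparable with [P].  As [e * (1 - e) = 0], an inclusion either way kills
    the smaller of the two: [e = 0] or [e = 1]
    ([idempotent_comparable_compl]). *)

Set Implicit Arguments.
Unset Strict Implicit.
Unset Printing Implicit Defensive.

Import Order.TTheory GRing.Theory.
Local Open Scope ring_scope.

Lemma odot_idem_le (d : Order.disp_t) (L : blAlgebraType d) (p x : L) :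
  (p ⊙ p = p)%O -> (x <= p)%O -> (p ⊙ x)%O = x.
Proof.
by move=> pp /meet_r <-; rewrite -divisibility odotA pp.
Qed.

Section PrincipalIdeals.
Variable R : comPzRingType.
Implicit Types (I P : ideal R) (a e x : R).

Lemma principal_is_ideal a : is_ideal (fun x => exists r, x = r * a).
Proof.
split=> [|_ _ [r ->] [s ->]|b _ [r ->]].
- by exists 0; rewrite mul0r.
- by exists (r + s); rewrite mulrDl.
- by exists (b * r); rewrite mulrA.
Qed.

Definition principal a : ideal R := Ideal (principal_is_ideal a).

Lemma mem_principal a : principal a a.
Proof. by exists 1; rewrite mul1r. Qed.

Lemma principal_le a I : (principal a <= I)%O = `[< I a >].
Proof.
apply/id_leP/asboolP => [|Ia _ [r ->]]; last exact: idealMl.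
by apply; apply: mem_principal.
Qed.

Lemma idM_principal P a x :
  (P ⊙ principal a)%O x -> exists2 e, P e & x = e * a.
Proof.
case=> n [u [v [Pu va ->]]]; have [r vE] := choice va.
exists (\sum_k u k * r k); first by apply: ideal_sum => k; exact: Defs.idealMr.
by rewrite mulr_suml; apply: eq_bigr => k _; rewrite vE mulrA.
Qed.

Lemma principal_idem e :
  e * e = e -> (principal e ⊙ principal e)%O = principal e.
Proof.
move=> ee; apply: le_anti; apply/andP; split.
  by apply/idM_leP => a b _ [s ->]; exists (a * s); rewrite mulrA.
rewrite principal_le; apply/asboolP.
by have := idM_mem (mem_principal e) (mem_principal e); rewrite ee.
Qed.

Definition locally_unital P := forall x, P x -> exists2 e, P e & e * x = x.

Lemma common_local_unit P x y : locally_unital P -> P x -> P y ->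
  exists e, [/\ P e, e * x = x & e * y = y].
Proof.
move=> Pu Px Py; have [e1 Pe1 e1x] := Pu x Px.
(* [e2] only needs to fix the part of [y] that [e1] misses. *)
have [|e2 Pe2 e2y] := Pu (y - e1 * y).
  by apply: idealD => //; rewrite -mulNr; apply: idealMl.
exists (e1 + e2 - e2 * e1); split.
- apply: idealD; first exact: idealD.
  by rewrite -mulNr; apply: idealMl.
- by rewrite !mulrDl mulNr -mulrA e1x addrK.
- rewrite !mulrDl mulNr -mulrA -addrA -mulrBr e2y.
  by rewrite addrC subrK.
Qed.

(** The orthogonality [e * (1 - e) = 0] forces comparable complementary
    ideals to be trivial. *)
Lemma idempotent_comparable_compl e : e * e = e ->
  (principal (1 - e) >=< principal e)%O -> e = 0 \/ e = 1.
Proof.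
move=> ee; rewrite /Order.comparable !principal_le.
case/orP => /asboolP[r rE]; [right|left].
  apply/eqP; rewrite eq_sym -subr_eq0 rE -ee mulrA -rE.
  by rewrite mulrBl mul1r ee subrr.
by rewrite -ee {1}rE -mulrA mulrBl mul1r ee subrr mulr0.
Qed.

End PrincipalIdeals.

Section FinitelyManyIdeals.
Variables (R : comPzRingType) (T : finType) (f : ideal R -> T).
Hypothesis f_inj : injective f.

(** An ideal with the largest number of ideals below it is maximal. *)
Lemma exists_maximal_ideal (S : ideal R -> Prop) (I0 : ideal R) : S I0 ->
  exists2 I, S I & forall J, S J -> (I <= J)%O -> (J <= I)%O.
Proof.
move=> SI0; pose below (I : ideal R) :=
  [set t | `[< exists2 J, (J <= I)%O & f J = t >]]%SET.
pose ranks n := `[< exists2 I, S I & #|below I| = n >].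
have ranks_ex : exists n, ranks n by exists #|below I0|; apply/asboolP; exists I0.
have ranks_ub n : ranks n -> (n <= #|T|)%N.
  by move/asboolP => [I _ <-]; apply: max_card.
case: (ex_maxnP ranks_ex ranks_ub) => _ /asboolP[I SI <-] Imax.
exists I => // J SJ IJ.
have sub : below I \subset below J.
  apply/fintype.subsetP => t; rewrite !inE => /asboolP[K KI Kt].
  by apply/asboolP; exists K => //; exact: le_trans KI IJ.
have /eqP E : below I == below J.
  by rewrite eqEcard sub; apply: Imax; apply/asboolP; exists J.
have : f J \in below I by rewrite E inE; apply/asboolP; exists J.
by rewrite inE => /asboolP[K KI /f_inj <-].
Qed.

(** Finiteness enters to make the local units uniform: a maximal principal
    ideal inside [P] absorbs every element of [P], because it is contained in
    the principal ideal of a common local unit. *)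
Lemma idempotent_generator (P : ideal R) : locally_unital P ->
  exists2 e, e * e = e & P = principal e.
Proof.
move=> Pu; pose S I := exists2 a, P a & I = principal a.
have [|_ [a Pa ->] amax] := @exists_maximal_ideal S (principal 0).
  by exists 0 => //; apply: ideal0.
have Pgen x : P x -> principal a x.
  move=> Px; have [e [Pe ea ex]] := common_local_unit Pu Pa Px.
  have /id_leP : (principal e <= principal a)%O.
    apply: amax; first by exists e.
    by rewrite principal_le; apply/asboolP; exists a; rewrite mulrC.
  by apply; exists x; rewrite mulrC.
have [e Pe ea] := Pu a Pa; have [r eE] := Pgen e Pe.
(* [e] fixes the generator [a], and [e] is itself a multiple of [a]. *)
exists e; first by rewrite {2}eE mulrCA ea.
apply: le_anti; apply/andP; split; last by rewrite principal_le; apply/asboolP.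
by apply/id_leP => x /Pgen[s ->]; exists (s * a); rewrite -mulrA [a * e]mulrC ea.
Qed.

End FinitelyManyIdeals.

Theorem theorem31 (d : Order.disp_t) (L : finBLAlgebraType d)
    (L_comet : is_BL_comet L) (pivot_lt1 : (pivot L < \top)%O) :
  ~ (exists R : comPzRingType, residuated_isomorphic (ideal R) L).
Proof.
case=> R [f [[g fK gK] [[fI _ fM _] [f0 f1]]]].
have f_inj := can_inj fK.
have f_le I J : (f I <= f J)%O = (I <= J)%O.
  by rewrite !leEmeet -fI (inj_eq f_inj).
have [+ _] := pivotP L; rewrite !inE => /and3P[/eqP pp /eqP pcomp _].
set P := g (pivot L); have fP : f P = pivot L by apply: gK.
have [e ee PE] : exists2 e, e * e = e & P = principal e.
  apply: (idempotent_generator f_inj) => x Px.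
  have [|e Pe xE] := @idM_principal _ P x x; last by exists e.
  suff -> : (P ⊙ principal x)%O = principal x by apply: mem_principal.
  apply: f_inj; rewrite fM fP odot_idem_le // -fP f_le principal_le.
  exact/asboolP.
have cc : (1 - e) * (1 - e) = 1 - e.
  by rewrite mulrBl mul1r mulrBr mulr1 ee subrr subr0.
have : f (principal (1 - e)) \in comparables (pivot L).
  by rewrite pcomp inE -fM principal_idem.
rewrite inE => /andP[_]; rewrite comparable_sym -fP /Order.comparable !f_le PE.
case/(idempotent_comparable_compl ee) => eE.
- move/eqP: L_comet; apply; rewrite -fP -f0; congr f.
  apply: le_anti; rewrite le0x andbT PE principal_le; exact/asboolP.
- move: pivot_lt1; rewrite lt_neqAle => /andP[/eqP + _]; apply.
  rewrite -fP -f1; congr f; apply: le_anti; rewrite lex1 /= PE eE.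
  by apply/id_leP => x _; exists x; rewrite mulr1.
Qed.
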